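(* Let $z_1,\ldots,z_N$ be i.i.d. uniform on the unit circle and $P(z)=\prod_{i=1}^N(z-z_i)$. Let $\gamma=\log\big(\cos(\pi/8)/\sin(\pi/8)\big)$. Then for every $\epsilon\in(0,1)$ and all sufficiently large $N$, $$\mathbb{P}\Big(\max_{|z|=1}|P(z)|^2\ge\exp\big(\gamma\sqrt\pi\,\epsilon\sqrt N/2\big)\Big)\ge1-\epsilon.$$ *)

(* Defs.v *)
From HB Require Import structures.
From mathcomp Require Import all_boot all_order all_algebra.
From mathcomp Require Import all_classical all_reals all_analysis.
From mathcomp Require Import complex.
Set Implicit Arguments. Unset Strict Implicit. Unset Printing Implicit Defensive.
Import Order.TTheory GRing.Theory Num.Theory.
Local Open Scope classical_set_scope.
Local Open Scope ring_scope.
Local Open Scope complex_scope.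

Section Defs.
Variable R : realType.

Definition circ (t : R) : R[i] := (cos t) +i* (sin t).

Lemma zero_lt_2pi : (0 : R) < 2 * pi.
Proof. by rewrite mulr_gt0 ?pi_gt0. Qed.

(* uniform probability on the angle interval [0, 2 pi]
   (pushed to the circle by circ, this is the uniform law on the circle) *)
Definition angle_law : set R -> \bar R :=
  uniform_prob (ltr_pwDr zero_lt_2pi (lexx 0) : 0 < 0 + 2 * pi).

(* expectation of f (x_1,...,x_n) for x_1,...,x_n i.i.d. with law angle_law,
   written as an iterated integral (product measure via Fubini-Tonelli) *)
Fixpoint iid_expect (n : nat) (f : seq R -> \bar R) : \bar R :=
  match n with
  | 0 => f [::]
  | n'.+1 => (\int[angle_law]_(t in setT) iid_expect n' (fun s => f (t :: s)))%E
  end.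

Definition iid_prob (n : nat) (E : set (seq R)) : \bar R :=
  iid_expect n (fun s => (\1_E s)%:E).

Definition randpoly (N : nat) (s : seq R) (z : R[i]) : R[i] :=
  \prod_(i < N) (z - circ (nth 0 s i)).

(* event: max_{|z|=1} |P(z)|^2 >= c  (the max is attained, by compactness) *)
Definition max_event (N : nat) (c : R) : set (seq R) :=
  [set s | exists z : R[i], `|z| = 1 /\ c%:C <= `|randpoly N s z| ^+ 2].

Definition gamma_const : R := ln (cos (pi / 8) / sin (pi / 8)).
End Defs.

(* Main.v *)
Require Import Defs.
From HB Require Import structures.
From mathcomp Require Import all_boot all_order all_algebra.
From mathcomp Require Import all_classical all_reals all_analysis.
From mathcomp Require Import complex.
From mathcomp Require Import measurable_realfun.
From mathcomp Require Import ring lra zify.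
Import Order.TTheory GRing.Theory Num.Theory.
Import numFieldNormedType.Exports.
Local Open Scope classical_set_scope.
Local Open Scope ring_scope.

(** Let S = z_1 + ... + z_N.

    First, log max |P|^2 >= |S|.  For rho < 1 one has the Fourier expansion
    log |e^(it) - rho|^2 = - 2 sum_k rho^k cos(k t) / k; integrating
    log |P(rho e^(i phi))|^2 against the nonnegative density 1 + h, where
    h(phi) = - Re (conj(S) e^(i phi)) / |S|, keeps only the first Fourier
    coefficient and gives rho |S|, and then rho tends to 1.

    Second, E |S|^(2k) / N^k tends to k!, the k-th moment of the exponential
    law.  Hence, for every real polynomial g with g^2 >= 1 on [0, theta], the
    probability that |S|^2 <= theta N is asymptotically at most E g(X)^2 with X
    exponential of parameter 1.  Laguerre polynomials provide a g with
    E g(X)^2 < eps as soon as theta <= 0.65 eps^2, and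
    theta = gamma^2 pi eps^2 / 4 satisfies this bound. *)

(** * Moments of the random walk *)

(* E |z_1 + ... + z_N|^(2k): for z uniform on the circle, the mean of |w + z|^(2k)
   is the sum over j of C(k, j)^2 |w|^(2j). *)
Fixpoint walk_moment (N k : nat) : nat :=
  if N is N'.+1 then (\sum_(j < k.+1) 'C(k, j) ^ 2 * walk_moment N' j)%N
  else (k == 0)%N.

(** Termwise comparison with the binomial expansion of [(1 + N) ^ k], using C(k, j) j! (k - j)! =
    k!. *)
Lemma walk_moment_le (N k : nat) : (walk_moment N k <= k`! * N ^ k)%N.
Proof.
elim: N k => [|N IHN] k /=; first by case: k => //= k.
rewrite -(add1n N) expnDn big_distrr /= leq_sum// => j _.
have jk : (j <= k)%N by rewrite -ltnS.
rewrite exp1n mul1n -mulnn -(bin_fact jk).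
have := leq_mul (leqnn ('C(k, j) * 'C(k, j))) (IHN j).
move=> /leq_trans; apply.
have := fact_gt0 (k - j); nia.
Qed.

(** The terms j = k and j = k - 1 of the recursion suffice: they reproduce the recursion in [N] of
    the falling factorial. *)
Lemma walk_moment_ge (N k : nat) : (k`! * N ^_ k <= walk_moment N k)%N.
Proof.
elim: N k => [|N IHN] k /=; first by case: k => [|k]; rewrite ?ffact0n ?muln0.
rewrite big_ord_recr/= binn exp1n mul1n.
case: k => [|k]; first by rewrite big_ord0 add0n (leq_trans _ (IHN 0)).
rewrite big_ord_recr/= binSn.
have H1 := IHN k; have H2 := IHN k.+1.
have -> : (N.+1 ^_ k.+1 = N ^_ k.+1 + k.+1 * N ^_ k)%N.
  rewrite ffactSS ffactnSr; have [kN|Nk] := leqP k N.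
    by rewrite [in RHS]mulnC -mulnDl addnS subnK.
  by rewrite ffact_small// !(muln0, mul0n).
rewrite mulnDr addnC leq_add// (leq_trans _ (leq_addl _ _))//.
rewrite factS; nia.
Qed.

Section WalkLimit.
Variable R : realFieldType.

(** The quotient on the right is the product of 1 - i / N over i < k. *)
Lemma ffact_ge (N k : nat) : (0 < N)%N ->
  1 - (k ^ 2)%:R / N%:R <= (N ^_ k)%:R / N%:R ^+ k :> R.
Proof.
move=> N0; have N0' : 0 < N%:R :> R by rewrite ltr0n.
elim: k => [|k IH]; first by rewrite mul0r ffactn0 expr0 divr1 subr0.
have [Nk|kN] := leqP N k.
  apply: (@le_trans _ _ 0); last by rewrite divr_ge0// exprn_ge0// ler0n.
  rewrite subr_le0 ler_pdivlMr// mul1r ler_nat; nia.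
rewrite ffactnSr natrM natrB 1?ltnW// exprSr.
have -> : (N ^_ k)%:R * (N%:R - k%:R) / (N%:R ^+ k * N%:R) =
    (N ^_ k)%:R / N%:R ^+ k * (1 - k%:R / N%:R) :> R.
  by rewrite -mulf_div mulrBl divff ?lt0r_neq0.
have a0 : 0 <= k%:R / N%:R :> R by rewrite divr_ge0.
have a1 : 0 <= 1 - k%:R / N%:R :> R.
  by rewrite subr_ge0 ler_pdivrMr// mul1r ler_nat ltnW.
apply: le_trans (ler_wpM2r a1 IH).
have -> : (k.+1 ^ 2)%:R = (k ^ 2)%:R + k%:R + k%:R + 1 :> R.
  by rewrite -!natrD natr1; congr _%:R; nia.
rewrite !mulrDl.
have b0 : 0 <= (k ^ 2)%:R / N%:R :> R by rewrite divr_ge0.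
have c0 : 0 <= 1 / N%:R :> R by rewrite divr_ge0.
nra.
Qed.

Lemma walk_moment_dist (N k : nat) : (0 < N)%N ->
  `|(walk_moment N k)%:R / N%:R ^+ k - k`!%:R| <= (k`! * k ^ 2)%:R / N%:R :> R.
Proof.
move=> N0; have N0' : 0 < N%:R :> R by rewrite ltr0n.
have Nk : 0 < N%:R ^+ k :> R by rewrite exprn_gt0.
have hi : (walk_moment N k)%:R / N%:R ^+ k <= k`!%:R :> R.
  by rewrite ler_pdivrMr// -natrX -natrM ler_nat walk_moment_le.
have lo : k`!%:R * ((N ^_ k)%:R / N%:R ^+ k) <= (walk_moment N k)%:R / N%:R ^+ k :> R.
  by rewrite mulrA -natrM ler_pM2r ?invr_gt0// ler_nat walk_moment_ge.
rewrite ler0_norm ?subr_le0// opprB.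
have := ler_wpM2l (ler0n R k`!) (@ffact_ge N k N0); rewrite natrM mulrBr mulr1 mulrA; lra.
Qed.

End WalkLimit.

(** * Laguerre test polynomials *)

(** Up to sign, a k-th finite difference of a polynomial of degree b < k in i; Pascal's rule lowers
    both k and b by one. *)
Lemma alt_bin_sum (R : comNzRingType) (k a b : nat) : (b < k)%N ->
  \sum_(i < k.+1) (-1) ^+ i * 'C(k, i)%:R * 'C(a + i, b)%:R = 0 :> R.
Proof.
elim: k a b => // k IH a b; rewrite ltnS => bk.
have -> : \sum_(i < k.+2) (-1) ^+ i * 'C(k.+1, i)%:R * 'C(a + i, b)%:R =
    \sum_(i < k.+1) (-1) ^+ i * 'C(k, i)%:R * ('C(a + i, b)%:R - 'C((a + i).+1, b)%:R) :> R.
  rewrite big_ord_recl /= bin0 expr0 addn0.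
  under eq_bigr do rewrite /bump/= add1n binS natrD mulrDr mulrDl.
  rewrite big_split/= big_ord_recr /= (@bin_small k k.+1)// mulr0n mulr0 mul0r addr0.
  under [RHS]eq_bigr do rewrite mulrBr.
  rewrite big_split/= [in RHS]big_ord_recl/= bin0 expr0 addn0 -!addrA; congr (_ + (_ + _)).
  by apply: eq_bigr => i _; rewrite addnS exprS mulN1r !mulNr.
case: b bk => [|b] bk.
  by rewrite big1// => i _; rewrite !bin0 subrr mulr0.
rewrite -[RHS]oppr0 -[in RHS](IH a b)// -sumrN; apply: eq_bigr => i _.
by rewrite -mulrN binS natrD opprD addrA subrr add0r.
Qed.

Lemma fact_bin_shift (i j : nat) : ((i + j.+1)`! = (i.+1)`! * (j`! * 'C(i.+1 + j, j)))%N.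
Proof. by rewrite addnS -addSn -(@bin_fact (i.+1 + j) j) ?leq_addl// addnK mulnC -mulnA mulnCA. Qed.

Section Laguerre.
Variable (R : realFieldType).

(* Coefficients of the associated Laguerre polynomial L_k^(1)(x) / (k + 1).  As n! is
   the n-th moment of the exponential law, [laguerre_sqnorm] computes the mean of the
   square of this polynomial, the least one among polynomials of degree k equal to 1
   at 0. *)
Definition laguerre_coef (k i : nat) : R := (-1) ^+ i * 'C(k, i)%:R / (i.+1)`!%:R.

(** Under the exponential law the polynomial is orthogonal to x, ..., x^k: for j > 0, dividing (i +
    j)! by (i + 1)! leaves a polynomial of degree j - 1 in i, which [alt_bin_sum] kills. *)
Lemma laguerre_orthogonal (k j : nat) : (j <= k)%N ->
  \sum_(i < k.+1) laguerre_coef k i * (i + j)`!%:R = (j == 0%N)%:R / k.+1%:R.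
Proof.
case: j => [|j] jk /=; rewrite /laguerre_coef.
  transitivity (\sum_(i < k.+1) (-1) ^+ i * 'C(k.+1, i.+1)%:R / k.+1%:R : R).
    apply: eq_bigr => i _; rewrite addn0 -mulrA -mulrA -mulrA; congr (_ * _).
    have /(congr1 (fun n => n%:R : R)) := mul_bin_diag k.+1 i.
    rewrite factS !natrM => /= H.
    have i0 : i.+1%:R != 0 :> R by rewrite pnatr_eq0.
    have k0 : k.+1%:R != 0 :> R by rewrite pnatr_eq0.
    have f0 : i`!%:R != 0 :> R by rewrite pnatr_eq0 -lt0n fact_gt0.
    rewrite invfM mulrA (mulfVK f0); apply: (mulfI k0); apply: (mulfI i0).
    rewrite [k.+1%:R * (_ / _)]mulrA H [i.+1%:R * _ / _]mulrAC mulfV// mul1r.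
    by rewrite [k.+1%:R * (_ / _)]mulrCA mulfV// mulr1.
  rewrite -mulr_suml; congr (_ / _).
  have := @alt_bin_sum R k.+1 0 0 isT.
  rewrite big_ord_recl /= !bin0 expr0 !mulr1.
  under eq_bigr do rewrite /bump/= add1n exprS bin0 mulr1 mulN1r mulNr.
  by rewrite sumrN => /subr0_eq/esym.
rewrite mul0r -[RHS](mulr0 (j`!%:R)) -[in RHS](@alt_bin_sum R k j.+1 j)// mulr_sumr.
apply: eq_bigr => i _.
rewrite fact_bin_shift natrM [(j`! * _)%:R]natrM (_ : (i.+1 + j = j.+1 + i)%N); last by lia.
have f0 : (i.+1)`!%:R != 0 :> R by rewrite pnatr_eq0 -lt0n fact_gt0.
by rewrite [_ * (_ * (_ * _))]mulrA mulfVK// mulrCA.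
Qed.

(** By orthogonality only the constant coefficient, equal to 1, contributes. *)
Lemma laguerre_sqnorm (k : nat) :
  \sum_(i < k.+1) \sum_(j < k.+1)
    laguerre_coef k i * laguerre_coef k j * (i + j)`!%:R = k.+1%:R^-1.
Proof.
rewrite exchange_big/=.
transitivity (\sum_(j < k.+1) laguerre_coef k j * ((j == 0 :> nat)%:R / k.+1%:R)).
  apply: eq_bigr => j _; rewrite -laguerre_orthogonal -1?ltnS// mulr_sumr.
  by apply: eq_bigr => i _; rewrite -mulrA mulrCA.
rewrite big_ord_recl big1 ?addr0 => [|i _]; last by rewrite /= mul0r mulr0.
by rewrite /laguerre_coef/= expr0 bin0 divr1 !mul1r.
Qed.

Lemma alternating_sum_ge0 (u : nat -> R) (n : nat) :
  (forall i, 0 <= u i) -> (forall i, u i.+1 <= u i) ->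
  0 <= \sum_(i < n) (-1) ^+ i * u i <= u 0.
Proof.
move=> u0; elim: n u u0 => [|n IH] u u0 ud; first by rewrite big_ord0 lexx u0.
have := IH (fun i => u i.+1) (fun i => u0 _) (fun i => ud _).
rewrite big_ord_recl expr0 mul1r.
under [X in _ + X]eq_bigr do rewrite /bump/= ?add1n exprS mulN1r mulNr.
rewrite sumrN; have := ud 0; lra.
Qed.

(** For k x <= 1 the terms alternate in sign and decrease in size, so what follows the first two, 1
    and - k x / 2, has a nonnegative sum. *)
Lemma laguerre_ge (k : nat) (x : R) : 0 <= x -> k%:R * x <= 1 ->
  1 - k%:R * x / 2 <= \sum_(i < k.+1) laguerre_coef k i * x ^+ i.
Proof.
move=> x0 kx.
pose u i : R := 'C(k, i)%:R / (i.+1)`!%:R * x ^+ i.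
have f0 n : 0 < n`!%:R :> R by rewrite ltr0n fact_gt0.
have u0 i : 0 <= u i by rewrite /u mulr_ge0 ?exprn_ge0// divr_ge0.
have ud i : u i.+1 <= u i.
  have [ki|ik] := leqP k i.
    by rewrite {1}/u bin_small// !mul0r.
  have /(congr1 (fun n => n%:R : R)) := mul_bin_left k i.
  rewrite !natrM natrB 1?ltnW// => H.
  have i0 : 0 < i.+1%:R :> R by rewrite ltr0n.
  have i20 : 0 < i.+2%:R :> R by rewrite ltr0n.
  have -> : u i.+1 = u i * ((k%:R - i%:R) * x / (i.+1%:R * i.+2%:R)).
    rewrite /u; have -> : 'C(k, i.+1)%:R = (k%:R - i%:R) * 'C(k, i)%:R / i.+1%:R :> R.
      by rewrite -H [_ / _]mulrC mulKf// lt0r_neq0.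
    rewrite (factS i.+1) natrM exprS !invfM; ring.
  rewrite -[leRHS]mulr1 ler_wpM2l// ler_pdivrMr ?mulr_gt0// mul1r.
  apply: (@le_trans _ _ 1).
    rewrite (le_trans _ kx)// ler_wpM2r// gerBl ler0n//.
  by rewrite -natrM ler1n.
have E i : laguerre_coef k i * x ^+ i = (-1) ^+ i * u i.
  by rewrite /laguerre_coef /u !mulrA.
under eq_bigr do rewrite E.
have u00 : u 0 = 1 by rewrite /u bin0 expr0 divr1 mulr1.
have u1 : u 1 = k%:R * x / 2 by rewrite /u bin1 expr1 mulrAC.
case: k u u0 ud E u00 u1 kx => [|k] u u0 ud E u00 u1 kx.
  by rewrite big_ord1 expr0 u00; lra.
rewrite !big_ord_recl.
under [X in _ + (_ + X)]eq_bigr do rewrite /bump/= ?add1n !exprS !mulN1r opprK.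
have /andP[+ _] := @alternating_sum_ge0 (fun i => u i.+2) k (fun i => u0 _) (fun i => ud _).
rewrite /bump/= expr0 expr1 u00 u1; lra.
Qed.
End Laguerre.

Section TestPoly.
Variable R : archiRealFieldType.

(** Dividing by the lower bound [d] makes the polynomial at least 1 on [0, theta], with mean square
    1 / ((k + 1) d^2). *)
Lemma laguerre_test (k : nat) (theta eps : R) :
  0 < theta -> k%:R * theta <= 1 ->
  1 < eps * k.+1%:R * (1 - k%:R * theta / 2) ^+ 2 ->
  exists K (a : nat -> R),
    (forall x, 0 <= x <= theta -> 1 <= (\sum_(i < K) a i * x ^+ i) ^+ 2) /\
    \sum_(i < K) \sum_(j < K) a i * a j * (i + j)`!%:R < eps.
Proof.
move=> t0 kt H; set d := 1 - k%:R * theta / 2 in H.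
have d0 : 0 < d by rewrite /d; lra.
exists k.+1, (fun i => laguerre_coef R k i / d); split.
  move=> x /andP[x0 xt].
  have kx : k%:R * x <= k%:R * theta by rewrite ler_wpM2l.
  have L := @laguerre_ge R k x x0 (le_trans kx kt).
  have -> : \sum_(i < k.+1) laguerre_coef R k i / d * x ^+ i =
            (\sum_(i < k.+1) laguerre_coef R k i * x ^+ i) / d.
    by rewrite mulr_suml; apply: eq_bigr => i _; rewrite mulrAC.
  rewrite exprn_ege1// ler_pdivlMr// mul1r (le_trans _ L)//.
  rewrite /d; lra.
have -> : \sum_(i < k.+1) \sum_(j < k.+1)
    laguerre_coef R k i / d * (laguerre_coef R k j / d) * (i + j)`!%:R
    = k.+1%:R^-1 / d ^+ 2.
  rewrite -laguerre_sqnorm mulr_suml; apply: eq_bigr => i _.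
  rewrite mulr_suml; apply: eq_bigr => j _; rewrite expr2 invfM; ring.
rewrite -invfM invf_plt ?posrE ?mulr_gt0 ?exprn_gt0//; last first.
  have : 0 < k.+1%:R * d ^+ 2 by rewrite mulr_gt0 ?exprn_gt0.
  by move=> p; rewrite -(pmulr_rgt0 _ p) mulrC mulrA (lt_trans ltr01).
have e0 : 0 < eps.
  have : 0 < k.+1%:R * d ^+ 2 by rewrite mulr_gt0 ?exprn_gt0.
  by move=> p; rewrite -(pmulr_rgt0 _ p) mulrC mulrA (lt_trans ltr01).
by rewrite -[eps^-1]mul1r ltr_pdivrMr// mulrC mulrA.
Qed.

Lemma exists_test_polynomial (theta eps : R) :
  0 < eps < 1 -> theta <= 13%:R / 20%:R * eps ^+ 2 ->
  exists K (a : nat -> R),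
    (forall x, 0 <= x <= theta -> 1 <= (\sum_(i < K) a i * x ^+ i) ^+ 2) /\
    \sum_(i < K) \sum_(j < K) a i * a j * (i + j)`!%:R < eps.
Proof.
move=> /andP[e0 e1] tle.
suff [K [a [aP aE]]] : exists K (a : nat -> R),
    (forall x, 0 <= x <= 13%:R / 20%:R * eps ^+ 2 -> 1 <= (\sum_(i < K) a i * x ^+ i) ^+ 2) /\
    \sum_(i < K) \sum_(j < K) a i * a j * (i + j)`!%:R < eps.
  exists K, a; split => // x /andP[x0 xt]; apply: aP; rewrite x0/=; exact: le_trans tle.
set t := 13%:R / 20%:R * eps ^+ 2.
have e2 : 0 < eps ^+ 2 by rewrite exprn_gt0.
have t0 : 0 < t by rewrite /t; lra.
(* k of order 2 / (3 t) for small eps; k = 2 for middle values *)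
have [el|el] := leP eps (9%:R / 20%:R).
  (* On k t <= 1, k (1 - k t / 2)^2 is largest at k t = 2/3. The requirement becomes 8 eps / (27 t)
     > 1, that is eps < 160/351, and 9/20 is below this value. *)
  set y := 2 / (3 * t).
  have y0 : 0 <= y by rewrite divr_ge0// mulr_ge0// ltW.
  have /andP[] := Num.Theory.truncn_itv y0.
  set k := Num.trunc y => ky yk.
  have kt : k%:R * t <= 2 / 3.
    have := ler_wpM2r (ltW t0) ky; rewrite /y (_ : 2 / (3 * t) * t = 2 / 3)//.
    by field; rewrite lt0r_neq0.
  have k1t : 2 / 3 < k.+1%:R * t.
    have := yk; rewrite -(ltr_pM2r t0 y) /y (_ : 2 / (3 * t) * t = 2 / 3)//.
    by field; rewrite lt0r_neq0.
  apply: (@laguerre_test k t) => //; first lra.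
  have d1 : 2 / 3 <= 1 - k%:R * t / 2 by lra.
  have d2 : 4 / 9 <= (1 - k%:R * t / 2) ^+ 2 by nra.
  have d4 : 0 < eps * k.+1%:R by rewrite mulr_gt0.
  apply: (@lt_le_trans _ _ (eps * k.+1%:R * (4 / 9))); last by rewrite ler_pM2l.
  rewrite -(ltr_pM2r t0) mul1r.
  have -> : eps * k.+1%:R * (4 / 9) * t = (k.+1%:R * t) * eps * (4/9) by ring.
  apply: (@lt_trans _ _ (2 / 3 * eps * (4 / 9))).
    by rewrite /t; nra.
  rewrite ltr_pM2r; [by rewrite ltr_pM2r|lra].
have [eu|eu] := leP eps (67%:R / 100%:R).
  have tt : t <= 1 / 2 by rewrite /t; nra.
  apply: (@laguerre_test 2 t) => //; first lra.
  rewrite (_ : 2 * t / 2 = t); last by field.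
  (* A hint towards 3 eps (1 - t)^2 > 1, nonnegative between the two thresholds on [eps]. *)
  have q0 : 0 <= (eps - 9%:R / 20%:R) * (67%:R / 100%:R - eps) *
     (3 + 2 * eps - 2 * eps ^+ 2 - 2 * eps ^+ 3).
    rewrite !mulr_ge0//; first lra; first lra.
    nra.
  rewrite /t; nra.
(* For eps close to 1, Cantelli's inequality, i.e. the affine g proportional to
   1 + 1 / (1 - t) - x. *)
have t1 : t < 1 by rewrite /t; nra.
set d := 1 - t; have d0 : 0 < d by rewrite /d; lra.
pose b := d + d^-1.
have b0 : 0 < b by rewrite addr_gt0 ?invr_gt0.
exists 2%N, (fun i => if i == 0%N then (1 + d^-1) / b else - b^-1); split.
  move=> x /andP[x0 xt]; rewrite !big_ord_recl big_ord0 /= /bump/= expr0 expr1.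
  rewrite exprn_ege1// mulr1 addr0 mulNr [b^-1 * x]mulrC -mulrBl ler_pdivlMr// mul1r.
  rewrite /b /d; move: xt; rewrite -/t; lra.
rewrite !big_ord_recl !big_ord0 /= /bump/= !addr0.
(* The exponential law has mean and variance 1, so E (1 + 1/d - X)^2 = 1 + 1/d^2, to be divided by
   b^2. *)
rewrite (_ : _ + _ = (1 + d ^+ 2)^-1); last first.
  rewrite (_ : 2`! = 2%N)// (_ : 1`! = 1%N)// (_ : 0`! = 1%N)// /b; field.
  by rewrite !lt0r_neq0// ?mulr_gt0//; nra.
rewrite -[eps]invrK ltf_pV2 ?posrE ?invr_gt0//; last by rewrite ltr_wpDr ?sqr_ge0.
rewrite -[eps^-1]mul1r ltr_pdivrMr// /d /t.
have h1 : 0 <= (eps - 67%:R / 100%:R) * (1 - eps) by rewrite mulr_ge0; lra.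
have h2 : 0 <= (eps - 67%:R / 100%:R) * (1 - eps) * eps by rewrite mulr_ge0// ltW.
set D := 1 - _.
(* Bounds D^2 below by its tangent at 65/100, which leaves a cubic in [eps] settled by [h1] and
   [h2]. *)
have h3 : 0 <= eps * (D - 65%:R / 100%:R) ^+ 2 by rewrite mulr_ge0 ?sqr_ge0// ltW.
have : 1 < eps * (1 + (130%:R / 100%:R * D - 4225%:R / 10000%:R)) by rewrite /D; lra.
by move: h3; clear; nra.
Qed.
End TestPoly.

(** * The constant gamma *)

Section Constant.
Variable R : realType.

(** At x = pi / 8 this yields the upper bound pi <= 8 tan(pi / 8). *)
Lemma le_tan (x : R) : 0 <= x < pi / 2 -> x <= tan x.
Proof.
move=> /andP[x0 xp].
have cosN0 y : 0 <= y -> y <= x -> cos y != 0.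
  move=> y0 yx; rewrite gt_eqF// cos_gt0_pihalf// (le_lt_trans yx xp) andbT.
  by rewrite (lt_le_trans _ y0)// oppr_lt0 divr_gt0 ?pi_gt0.
have [|c|c] := @MVT_segment R tan (fun y => (cos y) ^- 2) 0 x x0.
- by move=> y; rewrite in_itv/= => /andP[/ltW y0 /ltW yx]; apply/is_derive_tan/cosN0.
- apply: derivable_within_continuous => y; rewrite in_itv/= => /andP[y0 yx].
  exact/derivable_tan/cosN0.
- rewrite in_itv/= tan0 !subr0 => /andP[c0 cx] ->.
  rewrite ler_peMl// -exprVn -[leLHS](expr1n _ 2) lerXn2r ?nnegrE//.
  + rewrite invr_ge0 cos_ge0_pihalf// (le_trans cx (ltW xp)) andbT.
    by rewrite (le_trans _ c0)// oppr_le0 divr_ge0 ?pi_ge0.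
  + have cc : 0 < cos c.
      rewrite cos_gt0_pihalf// (le_lt_trans cx xp) andbT.
      by rewrite (lt_le_trans _ c0)// oppr_lt0 divr_gt0 ?pi_gt0.
    by rewrite invf_ge1// cos_le1.
Qed.

Lemma expR_ge_partial_sum (x : R) (n : nat) : 0 <= x ->
  \sum_(0 <= i < n) x ^+ i / i`!%:R <= expR x.
Proof.
move=> x0; apply: (nondecreasing_cvgn_le _ (is_cvg_series_exp_coeff x)).
by apply: nondecreasing_series => i _ _; rewrite exp_coeff_ge0.
Qed.

(** 483/200 is slightly above cot(pi / 8) = 1 + sqrt 2, so 177/200 will bound gamma from above. *)
Lemma expR_177_200_ge : 483%:R / 200%:R <= expR (177%:R / 200%:R : R).
Proof.
have := @expR_ge_partial_sum (177%:R / 200%:R) 5.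
rewrite /index_iota/= !big_cons big_nil.
rewrite (_ : 0`! = 1%N)// (_ : 1`! = 1%N)// (_ : 2`! = 2%N)// (_ : 3`! = 6%N)// (_ : 4`! = 24%N)//.
have y0 : 0 <= 177%:R / 200%:R :> R by lra.
move=> /(_ y0); move: y0; set y : R := _ / _ => y0 /(le_trans _); apply.
have : 783%:R / 1000%:R <= y ^+ 2 by rewrite /y; lra.
have : 693%:R / 1000%:R <= y ^+ 3 by rewrite /y; lra.
have : 613%:R / 1000%:R <= y ^+ 4 by rewrite /y; lra.
rewrite expr0 expr1 /y; lra.
Qed.

(** t = cot(pi / 8) is the positive root of t^2 = 2 t + 1, which encloses t and thereby bounds gamma
    = ln t and pi <= 8 / t. The value 13/5 is four times the 13/20 of [exists_test_polynomial]. *)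
Lemma gamma_const_bound : 0 <= gamma_const R /\ gamma_const R ^+ 2 * pi <= 13%:R / 5%:R.
Proof.
set x : R := pi / 8.
have p0 := pi_gt0 R.
have x0 : 0 < x by rewrite divr_gt0.
have xp : x < pi / 2 by rewrite /x; lra.
have s0 : 0 < sin x by rewrite sin_gt0_pihalf// x0.
have c0 : 0 < cos x by rewrite cos_gt0_pihalf// xp andbT (lt_trans _ x0)// oppr_lt0 divr_gt0.
have E1 : sin (x + x) = cos (x + x).
  by rewrite -cosBpihalf -cosN; congr cos; rewrite /x; field.
have E2 : 2 * (sin x * cos x) = cos x ^+ 2 - sin x ^+ 2.
  by move: E1; rewrite sinD cosD !expr2 [cos x * sin x]mulrC -mulr2n mulr_natl.
set t := cos x / sin x.
have t0 : 0 < t by rewrite divr_gt0.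
have Et : t ^+ 2 = 2 * t + 1.
  have : t ^+ 2 - 2 * t - 1 = (cos x ^+ 2 - sin x ^+ 2 - 2 * (sin x * cos x)) / sin x ^+ 2.
    by rewrite /t; field; rewrite gt_eqF.
  by rewrite -E2 subrr mul0r; lra.
have tl : 1207%:R / 500%:R <= t by move: t0 Et; clear; nra.
have tu : t <= 483%:R / 200%:R by move: t0 Et; clear; nra.
have pil : pi <= 8 / t.
  have := @le_tan x; rewrite (ltW x0) xp => /(_ isT).
  by rewrite /tan (_ : sin x / cos x = t^-1) ?invf_div// /x ler_pdivrMr// mulrC.
have piu : pi <= (663%:R / 200%:R : R).
  by rewrite (le_trans pil)// ler_pdivrMr//; move: tl; clear; lra.
have g0 : 0 <= gamma_const R by rewrite /gamma_const -/x -/t ln_ge0//; move: tl; clear; lra.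
have gu : gamma_const R <= 177%:R / 200%:R.
  by rewrite /gamma_const -/x -/t -[leRHS]expRK ler_ln ?posrE ?expR_gt0// (le_trans tu)// expR_177_200_ge.
have g2 : gamma_const R ^+ 2 <= 98%:R / 125%:R.
  by move: g0 gu; clear; nra.
split=> //; move: g2 piu p0 (sqr_ge0 (gamma_const R)); clear; nra.
Qed.

End Constant.

(** * Lower bound for the maximum modulus *)

Section LogExpansion.
Variable R : realType.
Implicit Types (rho t x a b : R) (K m n : nat).

(* |e^(it) - rho|^2 *)
Definition sqdist rho t : R := 1 - 2 * rho * cos t + rho ^+ 2.

Lemma cos_add_cos x y : cos (x + y) + cos (x - y) = 2 * cos x * cos y :> R.
Proof. rewrite cosD cosB; ring. Qed.

Lemma sqdist_ge rho t : 0 <= rho -> (1 - rho) ^+ 2 <= sqdist rho t.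
Proof. by move=> r0; rewrite /sqdist; have := cos_le1 t; nra. Qed.

Lemma sqdist_gt0 rho t : 0 <= rho < 1 -> 0 < sqdist rho t.
Proof.
move=> /andP[r0 r1]; apply: lt_le_trans (sqdist_ge _ t r0).
by rewrite exprn_gt0// subr_gt0.
Qed.

(** Real part of a finite geometric sum of ratio x e^(it), multiplied by |1 - x e^(it)|^2. *)
Lemma sqdist_cos_sum x t K :
  sqdist x t * \sum_(k < K) x ^+ k * cos (k.+1%:R * t) =
  cos t - x - x ^+ K * cos (K.+1%:R * t) + x ^+ K.+1 * cos (K%:R * t).
Proof.
elim: K => [|K IH].
  by rewrite big_ord0 mulr0 expr0 expr1 mul0r cos0 !mul1r; ring.
rewrite big_ord_recr/= mulrDr IH /sqdist !exprS.
have := cos_add_cos (K.+1%:R * t) t.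
have -> : K.+1%:R * t + t = K.+2%:R * t by rewrite -[K.+2%:R]natr1; ring.
have -> : K.+1%:R * t - t = K%:R * t by rewrite -[K.+1%:R]natr1; ring.
move: (cos (K.+1%:R * t)) (cos (K.+2%:R * t)) (cos (K%:R * t)) => c1 c2 c0 H.
have -> : c2 = 2 * c1 * cos t - c0 by rewrite -H; ring.
ring.
Qed.

Lemma is_derive_cos_sum x t K :
  is_derive x 1 (fun x => \sum_(k < K) x ^+ k.+1 / k.+1%:R * cos (k.+1%:R * t))
    (\sum_(k < K) x ^+ k * cos (k.+1%:R * t)).
Proof.
have -> : (fun x => \sum_(k < K) x ^+ k.+1 / k.+1%:R * cos (k.+1%:R * t)) =
  \sum_(k < K) (fun x => x ^+ k.+1 / k.+1%:R * cos (k.+1%:R * t)).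
  by apply/funext => y; rewrite fct_sumE.
apply: is_derive_sum => k.
have -> : (fun x => x ^+ k.+1 / k.+1%:R * cos (k.+1%:R * t)) =
  (cos (k.+1%:R * t) / k.+1%:R) \*: (@id R ^+ k.+1).
  by apply/funext => y; rewrite /= exprfctE /GRing.scale/= mulrC mulrA mulrAC.
apply: is_derive_eq; rewrite /= /GRing.scale/= mulr1 mulrA divfK ?pnatr_eq0//.
by rewrite mulrC.
Qed.

(** The difference [F] vanishes at 0 and, by [sqdist_cos_sum], its derivative in x reduces to two
    terms of order x^K over [sqdist]; the mean value theorem concludes. *)
Lemma ln_sqdist_approx rho t K : 0 <= rho < 1 ->
  `|ln (sqdist rho t) + 2 * \sum_(k < K) rho ^+ k.+1 / k.+1%:R * cos (k.+1%:R * t)|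
    <= 4 * rho ^+ K / (1 - rho) ^+ 2.
Proof.
move=> /andP[r0 r1].
pose F x := ln (sqdist x t) + 2 * \sum_(k < K) x ^+ k.+1 / k.+1%:R * cos (k.+1%:R * t).
pose dF x := 2 * (x ^+ K.+1 * cos (K%:R * t) - x ^+ K * cos (K.+1%:R * t)) / sqdist x t.
have dFE x : 0 <= x < 1 -> is_derive x 1 F (dF x).
  move=> x01; have q0 := sqdist_gt0 x t x01.
  have dq : is_derive x 1 (sqdist ^~ t) (2 * x - 2 * cos t).
    have -> : sqdist ^~ t = cst (1 : R) + (- 2 * cos t) \*: (@id R) + (@id R) ^+ 2.
      apply/funext => y.
      by change (1 - 2 * y * cos t + y ^+ 2 = 1 + - 2 * cos t * y + y ^+ 2); ring.
    have d1 := @is_derive_id R R x 1.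
    have d2 := @is_deriveX R R id 2 x 1 1 d1.
    have d3 := @is_deriveZ R R R id (- 2 * cos t) x 1 1 d1.
    have d4 := @is_derive_cst R R R (1 : R) x 1.
    apply: (is_derive_eq (is_deriveD (is_deriveD d4 d3) d2)).
    by change (0 + - 2 * cos t * 1 + 2 * x ^+ 1 * 1 = 2 * x - 2 * cos t); ring.
  have dl : is_derive x 1 (fun y => ln (sqdist y t)) ((sqdist x t)^-1 * (2 * x - 2 * cos t)).
    exact: (@is_derive1_comp R (@ln R) (sqdist ^~ t) x _ _ (is_derive1_ln q0) dq).
  have ds := is_derive_cos_sum x t K.
  have -> : F = (fun y => ln (sqdist y t)) +
    2 \*: (fun x => \sum_(k < K) x ^+ k.+1 / k.+1%:R * cos (k.+1%:R * t)).
    by apply/funext => y; rewrite /F.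
  apply: is_derive_eq; rewrite /dF /GRing.scale/=.
  have := sqdist_cos_sum x t K; set S := \sum_(k < K) _ => HS.
  apply: (mulfI (lt0r_neq0 q0)).
  rewrite mulrDr mulrA mulfV ?lt0r_neq0// mul1r mulrCA HS [RHS]mulrC divfK ?lt0r_neq0//.
  ring.
have [|c|c] := @MVT_segment R F dF 0 rho r0.
- by move=> x; rewrite in_itv/= => /andP[/ltW x0 xr]; apply: dFE; rewrite x0 (lt_trans xr).
- apply: derivable_within_continuous => x; rewrite in_itv/= => /andP[x0 xr].
  by have [] := dFE x _; rewrite ?x0 ?(le_lt_trans xr).
rewrite in_itv/= => /andP[c0 cr].
have -> : F 0 = 0.
  rewrite /F /sqdist mulr0 mul0r expr0n subr0 addr0 ln1 add0r big1 ?mulr0// => k _.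
  by rewrite expr0n/= !mul0r.
rewrite !subr0 -/(F rho) => ->.
have c1 : c < 1 by rewrite (le_lt_trans cr).
have q0 : 0 < sqdist c t by rewrite sqdist_gt0// c0.
rewrite /dF !normrM normfV [`|2|]gtr0_norm// (gtr0_norm q0) (ger0_norm r0).
have qr : (1 - rho) ^+ 2 <= sqdist c t.
  apply: le_trans (sqdist_ge _ t c0); rewrite lerXn2r ?nnegrE; lra.
have r2 : 0 < (1 - rho) ^+ 2 by rewrite exprn_gt0// subr_gt0.
have h : `|c ^+ K.+1 * cos (K%:R * t) - c ^+ K * cos (K.+1%:R * t)| <= 2 * rho ^+ K.
  rewrite (le_trans (ler_normB _ _))// !normrM (_ : 2 * rho ^+ K = rho ^+ K + rho ^+ K); last by ring.
  rewrite lerD//.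
    rewrite -[leRHS]mulr1 ler_pM// ?cos_max//.
    rewrite ger0_norm ?exprn_ge0// exprS -[leRHS]mul1r ler_pM ?exprn_ge0 ?(ltW c1)//.
    by rewrite lerXn2r ?nnegrE.
  rewrite -[leRHS]mulr1 ler_pM// ?cos_max//.
  by rewrite ger0_norm ?exprn_ge0// lerXn2r ?nnegrE.
rewrite -[leRHS]mulr1 ler_pM ?mulr_ge0 ?invr_ge0 ?(ltW q0)// ?(ltW r1)//.
rewrite ler_pM ?mulr_ge0 ?invr_ge0 ?(ltW q0)//.
  by rewrite (_ : 4 = 2 * 2) -?mulrA ?ler_pM2l//; ring.
by rewrite lef_pV2 ?posrE.
Qed.
End LogExpansion.

(** * Averages over roots of unity *)

Section RootAverage.
Variable R : realType.
Implicit Types (rho t x a b : R) (K m n : nat).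

(* Averages over m-th roots of unity are exact on trigonometric polynomials of degree
   less than m and so replace integrals over the circle. *)
Definition root_angle m (j : nat) : R := j%:R * (2 * pi / m%:R).

(** Multiplication by sin(n pi / m), nonzero as 0 < n < m, makes the sum telescope; the arguments of
    its end terms differ by n full turns. *)
Lemma sum_cos_root_angle m n b : (0 < n < m)%N ->
  \sum_(j < m) cos (n%:R * root_angle m j + b) = 0.
Proof.
move=> /andP[n0 nm]; have m0 : (0 < m)%N by apply: leq_trans nm.
have mR : m%:R != 0 :> R by rewrite pnatr_eq0 -lt0n.
pose u : R := n%:R * pi / m%:R.
have su : sin u != 0.
  rewrite gt_eqF// sin_gt0_pi// divr_gt0 ?mulr_gt0 ?ltr0n ?pi_gt0//=.
  by rewrite ltr_pdivrMr ?ltr0n// mulrC ltr_pM2l ?pi_gt0// ltr_nat.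
apply: (mulfI su); rewrite mulr0.
pose g (j : nat) : R := sin ((j%:R * 2 - 1) * u + b) / 2.
transitivity (\sum_(0 <= j < m) (g j.+1 - g j)).
  rewrite big_mkord mulr_sumr; apply: eq_bigr => j _.
  have -> : n%:R * root_angle m j + b = j%:R * 2 * u + b.
    by rewrite /root_angle /u; field.
  rewrite /g -[j.+1%:R]natr1.
  have -> : ((j%:R + 1) * 2 - 1) * u + b = (j%:R * 2 * u + b) + u by ring.
  have -> : (j%:R * 2 - 1) * u + b = (j%:R * 2 * u + b) - u by ring.
  by rewrite sinD sinB; field.
rewrite telescope_sumr// /g.
have -> : (m%:R * 2 - 1) * u + b = ((0%:R * 2 - 1) * u + b) + pi *+ 2 *+ n.
  by rewrite /u -[pi *+ 2 *+ n]mulr_natr -[pi *+ 2]mulr_natr; field.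
have per k x : sin (x + pi *+ 2 *+ k) = sin x.
  by elim: k => [|k IH]; rewrite ?mulr0n ?addr0// mulrSr addrA sinD2pi.
by rewrite per subrr.
Qed.

(** The density 1 + h, nonnegative for a unit vector (a, b), later taken opposite to S. *)
Definition raised_cosine a b t : R := 1 + (a * cos t + b * sin t).

Lemma sum_raised_cosine a b m : (1 < m)%N -> \sum_(j < m) raised_cosine a b (root_angle m j) = m%:R.
Proof.
move=> m1.
have H c := @sum_cos_root_angle m 1 c m1.
transitivity (\sum_(j < m) (1 + (a * cos (1%:R * root_angle m j + 0) +
    b * cos (1%:R * root_angle m j - pi / 2)))).
  by apply: eq_bigr => j _; rewrite mul1r addr0 cosBpihalf.
rewrite big_split/= big_split/= -!mulr_sumr !H !mulr0 !addr0 sumr_const card_ord//.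
Qed.

(** The product has frequencies n - 1, n and n + 1, all below m; only frequency 0, present when n =
    1, has a nonzero average. *)
Lemma sum_raised_cosine_cos a b m n t : (0 < n)%N -> (n.+1 < m)%N ->
  \sum_(j < m) raised_cosine a b (root_angle m j) * cos (n%:R * (root_angle m j - t)) =
  (n == 1%N)%:R * (m%:R / 2 * (a * cos t + b * sin t)).
Proof.
move=> n0 nm.
have Z k c : (0 < k < m)%N -> \sum_(j < m) cos (k%:R * root_angle m j + c) = 0.
  exact: sum_cos_root_angle.
pose S k c := \sum_(j < m) cos (k%:R * root_angle m j + c).
transitivity (S n (- (n%:R * t)) + a / 2 * (S n.+1 (- (n%:R * t)) + S n.-1 (- (n%:R * t)))
  + b / 2 * (S n.+1 (- (n%:R * t) - pi / 2) - S n.-1 (- (n%:R * t) - pi / 2))).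
  rewrite /S -sumrN -!big_split/= !mulr_sumr -!big_split/=; apply: eq_bigr => j _.
  set y := root_angle m j.
  rewrite !addrA !cosBpihalf.
  have -> : n.+1%:R * y - n%:R * t = n%:R * (y - t) + y by rewrite -[n.+1%:R]natr1; ring.
  have -> : n.-1%:R * y - n%:R * t = n%:R * (y - t) - y.
    have -> : n%:R = n.-1%:R + 1 :> R by rewrite natr1 prednK.
    by ring.
  have -> : n%:R * y - n%:R * t = n%:R * (y - t) by ring.
  by rewrite cosD cosB sinD sinB /raised_cosine; field.
rewrite /S !(Z n) ?n0 ?(ltnW nm)// !(Z n.+1)//.
have [n1|n1] := eqVneq n 1%N.
  rewrite n1 /=.
  have -> : \sum_(j < m) cos (0 * root_angle m j - 1 * t) = m%:R * cos t.
    under eq_bigr do rewrite mul0r add0r mul1r cosN.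
    by rewrite sumr_const card_ord mulr_natl.
  have -> : \sum_(j < m) cos (0 * root_angle m j + (- (1 * t) - pi / 2)) = m%:R * - sin t.
    under eq_bigr do rewrite mul0r add0r mul1r cosBpihalf sinN.
    by rewrite sumr_const card_ord mulr_natl.
  by field.
have n1m : (0 < n.-1 < m)%N.
  by case: n n0 nm n1 => [|[|n]]//= _ /ltnW/ltnW.
rewrite !(Z n.-1)// mul0r; ring.
Qed.
End RootAverage.

(** * Weighted averages of log |P|^2 and passage to the unit circle *)

Section CircleMax.
Variable R : realType.
Implicit Types (rho t x a b h : R) (K m n N : nat) (theta : nat -> R).

Lemma raised_cosine_ge0 a b t : a ^+ 2 + b ^+ 2 = 1 -> 0 <= raised_cosine R a b t.
Proof.
move=> ab; have cs := cos2Dsin2 t; rewrite /raised_cosine.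
have : (a * cos t + b * sin t) ^+ 2 <= 1.
  have -> : 1 = (a ^+ 2 + b ^+ 2) * (cos t ^+ 2 + sin t ^+ 2) by rewrite cs mulr1.
  by have := sqr_ge0 (a * sin t - b * cos t); nra.
nra.
Qed.

Lemma sqdist1_bounds t : 0 <= sqdist R 1 t <= 4.
Proof. by rewrite /sqdist; have := cos_le1 t; have := cos_geN1 t; lra. Qed.

(** Rests on the identity |e^(it) - rho|^2 = rho |e^(it) - 1|^2 + (1 - rho)^2. *)
Lemma sqdist_le rho t : 0 <= rho <= 1 ->
  sqdist R rho t <= sqdist R 1 t + (1 - rho) ^+ 2.
Proof. by rewrite /sqdist; have := cos_le1 t; nra. Qed.

(** The 6 is 5 + 1: a new factor f + h is at most 5, and its own h adds at most one more
    [6 ^ N * h]. A crude constant is enough, as h tends to 0 with [N] fixed. *)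
Lemma prod_add_le N (f : nat -> R) h : 0 <= h <= 1 -> (forall i, 0 <= f i <= 4) ->
  \prod_(i < N) (f i + h) <= \prod_(i < N) f i + 6 ^+ N * h.
Proof.
move=> /andP[h0 h1] f4.
suff : 0 <= \prod_(i < N) f i <= 6 ^+ N /\
    0 <= \prod_(i < N) (f i + h) <= \prod_(i < N) f i + 6 ^+ N * h.
  by case=> _ /andP[].
elim: N => [|N [/andP[p0 p6] /andP[q0 q6]]].
  by rewrite !big_ord0 expr0; split; lra.
rewrite !big_ord_recr /= exprSr.
have /andP[f0 f1] := f4 N.
move: (\prod_(i < N) f i) (\prod_(i < N) (f i + h)) (6 ^+ N) (f N) p0 p6 q0 q6 f0 f1.
move=> p q s y p0 p6 q0 q6 y0 y4.
have s0 : 0 <= s by lra.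
have py : 0 <= p * y by rewrite mulr_ge0.
have py6 : p * y <= s * 6 by rewrite ler_pM//; lra.
split; first by rewrite py py6.
have -> /= : 0 <= q * (y + h) by rewrite mulr_ge0// addr_ge0.
have h2 : q * (y + h) <= (p + s * h) * (y + h) by rewrite ler_wpM2r// addr_ge0.
have sh : 0 <= s * h by rewrite mulr_ge0.
have h3 : s * h * (y + h) <= s * h * 5 by rewrite ler_wpM2l//; lra.
have h4 : p * h <= s * h by rewrite ler_wpM2r.
by rewrite (le_trans h2)//; lra.
Qed.

Lemma ln_prod N (f : nat -> R) : (forall i, 0 < f i) ->
  ln (\prod_(i < N) f i) = \sum_(i < N) ln (f i).
Proof.
move=> f0; elim: N => [|N IH]; first by rewrite !big_ord0 ln1.
by rewrite !big_ord_recr/= lnM ?IH// posrE// prodr_gt0.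
Qed.

(** The retained frequencies reach K + 1, and K + 2 after multiplication by the weight, so K + 3
    nodes make the averages exact. The weights have mean 1 and do not amplify the truncation
    error. *)
Lemma raised_cosine_ln_sqdist_ge a b t rho K : a ^+ 2 + b ^+ 2 = 1 -> 0 <= rho < 1 ->
  - rho * (a * cos t + b * sin t) - 4 * rho ^+ K.+1 / (1 - rho) ^+ 2 <=
  K.+3%:R^-1 * \sum_(j < K.+3) raised_cosine R a b (root_angle R K.+3 j) *
    ln (sqdist R rho (root_angle R K.+3 j - t)).
Proof.
move=> ab rho01; set E := 4 * _ / _; set m := K.+3.
have m0 : 0 < m%:R :> R by rewrite ltr0n.
rewrite ler_pdivlMl//.
have -> : m%:R * (- rho * (a * cos t + b * sin t) - E) =
  \sum_(j < m) raised_cosine R a b (root_angle R m j) *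
    (- (2 * \sum_(k < K.+1) rho ^+ k.+1 / k.+1%:R * cos (k.+1%:R * (root_angle R m j - t))) - E).
  under [RHS]eq_bigr do rewrite mulrBr mulrN.
  rewrite sumrB -mulr_suml sum_raised_cosine// mulrBr sumrN; congr (_ - _).
  under [in RHS]eq_bigr do rewrite mulrCA mulr_sumr.
  rewrite -mulr_sumr exchange_big/=.
  transitivity (- (2 * \sum_(k < K.+1) rho ^+ k.+1 / k.+1%:R *
      ((k.+1 == 1%N)%:R * (m%:R / 2 * (a * cos t + b * sin t))))).
    rewrite big_ord_recl big1 => [|k _]; last by rewrite /= mul0r mulr0.
    by rewrite /= addr0 expr1; field.
  congr (- (2 * _)); apply: eq_bigr => k _.
  rewrite -(@sum_raised_cosine_cos _ a b m k.+1)//; last by rewrite !ltnS -ltnS.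
  by rewrite mulr_sumr; apply: eq_bigr => j _; rewrite mulrCA.
apply: ler_sum => j _; apply: ler_wpM2l; first exact: raised_cosine_ge0.
have := @ln_sqdist_approx R rho (root_angle R m j - t) K.+1 rho01.
by rewrite ler_norml -/E => /andP[+ _]; lra.
Qed.

(** A mean of the logarithm of the product, with nonnegative weights averaging to 1, is at most ln
    M. *)
Lemma ln_sup_ge N theta a b rho (M : R) K : a ^+ 2 + b ^+ 2 = 1 -> 0 <= rho < 1 ->
  (forall phi, \prod_(i < N) sqdist R rho (phi - theta i) <= M) ->
  - rho * (\sum_(i < N) (a * cos (theta i) + b * sin (theta i)))
    - N%:R * (4 * rho ^+ K.+1 / (1 - rho) ^+ 2) <= ln M.
Proof.
move=> ab rho01 HM.
set m := K.+3; have m0 : 0 < m%:R :> R by rewrite ltr0n.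
have M0 : 0 < M.
  by apply: lt_le_trans (HM 0); rewrite prodr_gt0// => i _; exact: sqdist_gt0.
apply: (@le_trans _ _ (m%:R^-1 * \sum_(j < m) raised_cosine R a b (root_angle R m j) *
    ln (\prod_(i < N) sqdist R rho (root_angle R m j - theta i)))).
  have lnP phi : ln (\prod_(i < N) sqdist R rho (phi - theta i)) =
      \sum_(i < N) ln (sqdist R rho (phi - theta i)).
    by apply: (ln_prod N (fun i => sqdist R rho (phi - theta i))) => i; exact: sqdist_gt0.
  under [in leRHS]eq_bigr do rewrite lnP mulr_sumr.
  rewrite exchange_big/= mulr_sumr mulr_sumr.
  rewrite (_ : N%:R * _ = \sum_(i < N) 4 * rho ^+ K.+1 / (1 - rho) ^+ 2); last first.
    by rewrite sumr_const card_ord mulr_natl.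
  rewrite -sumrB; apply: ler_sum => i _; exact: raised_cosine_ln_sqdist_ge.
rewrite ler_pdivrMl// -(sum_raised_cosine R a b m)// mulr_suml.
apply: ler_sum => j _; apply: ler_wpM2l; first exact: raised_cosine_ge0.
rewrite ler_ln ?posrE//.
by rewrite prodr_gt0// => i _; exact: sqdist_gt0.
Qed.

(** With rho = 1 - h, first K tends to infinity, then h to 0. *)
Lemma sup_circle_ge N theta a b (C : R) : a ^+ 2 + b ^+ 2 = 1 ->
  (forall phi, \prod_(i < N) sqdist R 1 (phi - theta i) <= C) ->
  expR (- \sum_(i < N) (a * cos (theta i) + b * sin (theta i))) <= C.
Proof.
move=> ab HC; set A := - _.
have C0 : 0 <= C.
  apply: le_trans (HC 0); rewrite prodr_ge0// => i _.
  by have /andP[] := sqdist1_bounds (0 - theta i).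
have main h : 0 < h < 1 -> expR ((1 - h) * A) <= C + 6 ^+ N * h ^+ 2.
  move=> /andP[h0 h1]; set M := C + _.
  have rho01 : 0 <= 1 - h < 1 by lra.
  have M0 : 0 < M by rewrite ltr_wpDl// mulr_gt0 ?exprn_gt0.
  rewrite -[leRHS]lnK ?posrE// ler_expR.
  have HM phi : \prod_(i < N) sqdist R (1 - h) (phi - theta i) <= M.
    apply: (@le_trans _ _ (\prod_(i < N) (sqdist R 1 (phi - theta i) + h ^+ 2))).
      apply: ler_prod => i _; rewrite ltW ?sqdist_gt0//=.
      have := @sqdist_le (1 - h) (phi - theta i).
      by rewrite (_ : 1 - (1 - h) = h); [apply; lra|ring].
    apply: le_trans (@prod_add_le N (fun i => sqdist R 1 (phi - theta i)) (h ^+ 2) _ _) _.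
    - by rewrite sqr_ge0 expr_le1// ltW.
    - by move=> i; exact: sqdist1_bounds.
    - by rewrite lerD2r.
  have HK K := @ln_sup_ge N theta a b (1 - h) M K ab rho01 HM.
  have cv : (fun K => - (1 - h) * (\sum_(i < N) (a * cos (theta i) + b * sin (theta i)))
     - N%:R * (4 * (1 - h) ^+ K.+1 / (1 - (1 - h)) ^+ 2)) @ \oo --> (1 - h) * A.
    rewrite (_ : (1 - h) * A = - (1 - h) * (\sum_(i < N) (a * cos (theta i) + b * sin (theta i)))
     - N%:R * (4 * 0 / (1 - (1 - h)) ^+ 2)); last first.
      by rewrite /A mulr0 mul0r mulr0 subr0 mulrN mulNr.
    apply: cvgB; first exact: cvg_cst.
    apply: cvgMr; apply: cvgMl; apply: cvgMr.
    rewrite (@cvg_shiftS _ (fun K => (1 - h) ^+ K)).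
    by apply: cvg_expr; rewrite ger0_norm; lra.
  rewrite -(cvg_lim (@Rhausdorff R) cv).
  by apply: limr_le; [exact: cvgP cv|exact: nearW].
apply/ler_addgt0Pr => e e0.
(* Collects two errors: e^A - e^((1 - h) A) <= h |A| e^A and 6^N h^2 <= h 6^N. *)
pose B := `|A| * expR A + 6 ^+ N.
have B0 : 0 < B by rewrite ltr_wpDl ?exprn_gt0// mulr_ge0// expR_ge0.
pose h := Num.min (1 / 2) (e / B).
have h0 : 0 < h by rewrite lt_min divr_gt0//= divr_gt0.
have h2 : h <= 1 / 2 by rewrite ge_min lexx.
have hB : h * B <= e by rewrite -ler_pdivlMr// ge_min lexx orbT.
have := main h; rewrite (_ : 0 < h < 1); last by lra.
move=> /(_ isT) H.
have : expR A - h * (`|A| * expR A) <= expR ((1 - h) * A).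
  rewrite (_ : (1 - h) * A = A + - (h * A)); last by ring.
  rewrite expRD (_ : expR A - _ = expR A * (1 - h * `|A|)); last by ring.
  rewrite ler_wpM2l ?expR_ge0// (le_trans _ (expR_ge1Dx _))// lerD2l lerN2.
  by rewrite ler_wpM2l ?(ltW h0)// ler_norm.
have p6 : 0 < 6 ^+ N :> R by rewrite exprn_gt0.
have : 6 ^+ N * h ^+ 2 <= h * 6 ^+ N by rewrite mulrC ler_wpM2r ?(ltW p6)//; nra.
move: hB H; rewrite /B mulrDr; lra.
Qed.

End CircleMax.

(** * The maximum of |P|^2 against the sum of the roots *)

Section MaxEvent.
Local Open Scope complex_scope.
Variable R : realType.

Lemma circ_norm (t : R) : `|circ t| = 1.
Proof. by rewrite /circ normc_def/= cos2Dsin2 sqrtr1. Qed.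

Lemma randpoly_circ (N : nat) (s : seq R) (phi : R) :
  `|randpoly N s (circ phi)| ^+ 2 =
  (\prod_(i < N) sqdist R 1 (phi - nth 0 s i))%:C.
Proof.
rewrite /randpoly normr_prod -prodrXl rmorph_prod; apply: eq_bigr => i _.
rewrite -add_Re2_Im2 /circ /sqdist /=; congr (_%:C).
rewrite cosB; have := cos2Dsin2 phi; have := cos2Dsin2 (nth 0 s i).
move: (cos phi) (sin phi) (cos _) (sin _) => a b c d h1 h2; nra.
Qed.

(** Otherwise |P|^2 <= e^L on the whole circle, and [sup_circle_ge] with (a, b) = - S / |S| gives
    e^|S| <= e^L. The strict hypothesis also ensures that S is nonzero. *)
Lemma max_event_of_lt (N : nat) (s : seq R) (L : R) : 0 <= L ->
  L ^+ 2 < (\sum_(i < N) cos (nth 0 s i)) ^+ 2 + (\sum_(i < N) sin (nth 0 s i)) ^+ 2 ->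
  max_event N (expR L) s.
Proof.
move=> L0; set X := \sum_(i < N) cos _; set Y := \sum_(i < N) sin _ => LXY.
apply: contrapT => nE.
have HC phi : \prod_(i < N) sqdist R 1 (phi - nth 0 s i) <= expR L.
  rewrite leNgt; apply/negP => H; apply: nE; exists (circ phi); split.
    exact: circ_norm.
  by rewrite randpoly_circ lecR ltW.
have D20 : 0 < X ^+ 2 + Y ^+ 2 by apply: le_lt_trans LXY; rewrite sqr_ge0.
set D := Num.sqrt (X ^+ 2 + Y ^+ 2).
have D0 : 0 < D by rewrite sqrtr_gt0.
have DE : D ^+ 2 = X ^+ 2 + Y ^+ 2 by rewrite sqr_sqrtr// ltW.
have ab : (- X / D) ^+ 2 + (- Y / D) ^+ 2 = 1.
  by rewrite !expr_div_n !sqrrN -mulrDl -DE mulfV// lt0r_neq0// exprn_gt0.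
have := @sup_circle_ge R N (nth 0 s) _ _ _ ab HC.
rewrite big_split/= -!mulr_sumr -/X -/Y.
have -> : - (- X / D * X + - Y / D * Y) = (X ^+ 2 + Y ^+ 2) / D.
  by field; rewrite lt0r_neq0.
rewrite -DE expr2 mulfK ?lt0r_neq0// ler_expR leNgt => /negP; apply.
by rewrite -(@ltr_pXn2r _ 2) ?nnegrE ?(ltW D0)// DE.
Qed.
End MaxEvent.

(** * Expectations over i.i.d. angles *)

Section AngleMean.
Variable R : realType.

Local Notation mu := (uniform_prob (ltr_pwDr (zero_lt_2pi R) (lexx 0))).

(** Integrability travels with the value, so that linearity leaves no side conditions. *)
Definition has_mean (f : R -> R) (v : R) :=
  mu.-integrable setT (EFin \o f) /\ (\int[mu]_t (f t)%:E = v%:E)%E.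

Lemma has_mean_cst (c : R) : has_mean (fun=> c) c.
Proof.
split; first exact: finite_measure_integrable_cst.
by rewrite integral_cst//= probability_setT mule1.
Qed.

Lemma has_meanD (f g : R -> R) (v w : R) : has_mean f v -> has_mean g w ->
  has_mean (fun t => f t + g t) (v + w).
Proof.
move=> [fi fv] [gi gw]; split.
  by have := integrableD measurableT fi gi.
have := integralD_EFin measurableT fi gi => /= H.
under eq_integral do rewrite EFinD.
by rewrite H fv gw.
Qed.

Lemma has_meanZ (k : R) (f : R -> R) (v : R) : has_mean f v ->
  has_mean (fun t => k * f t) (k * v).
Proof.
move=> [fi fv]; split.
  have := integrableZl measurableT k fi.
  by apply: eq_integrable => // t _; rewrite /= EFinM.
under eq_integral do rewrite EFinM.
by rewrite (integralZl measurableT fi) fv.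
Qed.

Lemma has_mean_sum (I : Type) (r : seq I) (f : I -> R -> R) (v : I -> R) :
  (forall i, has_mean (f i) (v i)) ->
  has_mean (fun t => \sum_(i <- r) f i t) (\sum_(i <- r) v i).
Proof.
move=> H; elim: r => [|i r IH].
  rewrite big_nil; have -> : (fun t => \sum_(i <- [::]) f i t) = fun=> 0.
    by apply/funext => t; rewrite big_nil.
  exact: has_mean_cst.
rewrite big_cons; have -> : (fun t => \sum_(j <- i :: r) f j t) =
    fun t => f i t + \sum_(j <- r) f j t.
  by apply/funext => t; rewrite big_cons.
exact: has_meanD.
Qed.

Lemma has_mean_cos (n : nat) (b : R) : (0 < n)%N ->
  has_mean (fun t => cos (n%:R * t + b)) 0.
Proof.
move=> n0; have nR : n%:R != 0 :> R by rewrite pnatr_eq0 -lt0n.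
(* Adding 1 gives the nonnegative integrand that [integral_uniform] requires; the constant is
   subtracted at the end. *)
pose g t : R := 1 + cos (n%:R * t + b).
have clin : continuous (fun t : R => n%:R * t + b).
  by move=> t; apply: cvgD; [apply: cvgMr; exact: cvg_id|exact: cvg_cst].
have cg : continuous g.
  move=> t; apply: cvgD; first exact: cvg_cst.
  exact: (continuous_comp (clin t) (@continuous_cos R _)).
have mg : measurable_fun setT g by exact: continuous_measurable_fun.
have pi2 : 0 < 2 * pi :> R by exact: zero_lt_2pi.
have Hg : has_mean g 1.
  split.
    apply: measurable_bounded_integrable => //.
      by rewrite ltey_eq fin_num_measure.
    exists 2; split; first by rewrite num_real.
    move=> M M2 t _ /=; rewrite (le_trans _ (ltW M2))// /g ler_norml.
    have := cos_le1 (n%:R * t + b); have := cos_geN1 (n%:R * t + b); lra.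
  rewrite integral_uniform; last 2 first.
  - exact/measurable_EFinP.
  - by move=> t; rewrite lee_fin /g; have := cos_geN1 (n%:R * t + b); lra.
  pose F t : R := t + sin (n%:R * t + b) / n%:R.
  have dF (t : R) : is_derive t (1 : R) F (g t).
    have d1 := @is_derive_id R R t 1.
    have d2 := @is_deriveZ R R R id n%:R t 1 1 d1.
    have d3 := is_deriveD d2 (@is_derive_cst R R R b t 1).
    have d4 := @is_derive1_comp R (@sin R) _ t _ _ (is_derive_sin _) d3.
    have d5 := @is_deriveZ R R R _ n%:R^-1 t 1 _ d4.
    have -> : F = id + n%:R^-1 \*: (@sin R \o (n%:R \*: id + cst b)).
      by apply/funext => y; rewrite /F mulrC.
    apply: (is_derive_eq (is_deriveD d1 d5)).
    change (1 + n%:R^-1 * (cos (n%:R * t + b) * (n%:R * 1 + 0)) = g t).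
    by rewrite /g; field.
  rewrite (@continuous_FTC2 R g F)//.
  - rewrite /F -EFinB -EFinM; congr _%:E.
    have -> : n%:R * (0 + 2 * pi) + b = (n%:R * 0 + b) + pi *+ 2 *+ n :> R.
      by rewrite -[pi *+ 2 *+ n]mulr_natr -[pi *+ 2]mulr_natr; ring.
    have per k x : sin (x + pi *+ 2 *+ k) = sin x :> R.
      by elim: k => [|k IH]; rewrite ?mulr0n ?addr0// mulrSr addrA sinD2pi.
    have p0 : pi != 0 :> R by rewrite gt_eqF// pi_gt0.
    by rewrite per; move: (pi : R) p0 => p p0; field; rewrite nR.
  - lra.
  - by apply: continuous_subspaceT => t; exact: cg.
  - split.
    + by move=> t _; case: (dF t).
    + apply: cvg_at_right_filter. apply: differentiable_continuous.
      by apply/derivable1_diffP; case: (dF 0).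
    + apply: cvg_at_left_filter. apply: differentiable_continuous.
      by apply/derivable1_diffP; case: (dF (0 + 2 * pi)).
  - by move=> t _; rewrite derive1E; case: (dF t).
have := has_meanD _ _ _ _ Hg (has_mean_cst (- 1)); rewrite subrr.
congr has_mean; apply/funext => t; rewrite /g; ring.
Qed.

End AngleMean.

(** * Even moments of |S| as iterated integrals *)

Section WalkMoments.
Local Open Scope complex_scope.
Variable R : realType.

Lemma circ_exp (t : R) (n : nat) : circ t ^+ n = circ (n%:R * t).
Proof.
elim: n => [|n IH]; first by rewrite expr0 mul0r /circ cos0 sin0.
rewrite exprS IH -[n.+1%:R]natr1 mulrDl mul1r /circ cosD sinD.
by apply/eqP; rewrite eq_complex /=; apply/andP; split; apply/eqP; ring.
Qed.

Lemma circ_mulJ (t : R) : circ t * (circ t)^* = 1.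
Proof.
apply/eqP; rewrite eq_complex /=; apply/andP; split; apply/eqP; last ring.
by rewrite mulrN opprK -!expr2 cos2Dsin2.
Qed.

(** As z times its conjugate is 1, the monomial has frequency i - j, and only frequency 0 has a
    nonzero mean. *)
Lemma has_mean_circ (c : R[i]) (i j : nat) :
  has_mean R (fun t => complex.Re (c * (circ t ^+ i * (circ t)^* ^+ j)))
    ((i == j)%:R * complex.Re c).
Proof.
have cs (n : nat) (u v : R) : (0 < n)%N ->
    has_mean R (fun t => u * cos (n%:R * t) + v * sin (n%:R * t)) 0.
  move=> n0; have -> : 0 = u * 0 + v * 0 :> R by rewrite !mulr0 addr0.
  apply: has_meanD; apply: has_meanZ.
    have := has_mean_cos R n 0 n0; congr has_mean.
    by apply/funext => t; rewrite addr0.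
  have := has_mean_cos R n (- (pi / 2)) n0; congr has_mean.
  by apply/funext => t; rewrite cosBpihalf.
case: c => u v.
have [ij|ji|->] := ltngtP i j; rewrite ?mul0r /=.
- have := cs (j - i)%N u v; rewrite subn_gt0 => /(_ ij); congr has_mean.
  apply/funext => t.
  have -> : (circ t)^* ^+ j = (circ t)^* ^+ i * (circ t)^* ^+ (j - i).
    by rewrite -exprD subnKC// ltnW.
  rewrite [circ t ^+ i * _]mulrA -exprMn circ_mulJ expr1n mul1r -rmorphXn/= circ_exp /circ/=; ring.
- have := cs (i - j)%N u (- v); rewrite subn_gt0 => /(_ ji); congr has_mean.
  apply/funext => t.
  have -> : circ t ^+ i = circ t ^+ (i - j) * circ t ^+ j by rewrite -exprD subnK// ltnW.
  rewrite -mulrA -exprMn circ_mulJ expr1n mulr1 circ_exp /circ/=; ring.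
- rewrite mul1r; have := has_mean_cst R u; congr has_mean.
  by apply/funext => t; rewrite -exprMn circ_mulJ expr1n mulr1.
Qed.

Lemma Re_sum (I : Type) (r : seq I) (F : I -> R[i]) :
  complex.Re (\sum_(i <- r) F i) = \sum_(i <- r) complex.Re (F i).
Proof. by apply: (big_morph (@complex.Re R)) => // -[a b] [c d]. Qed.

Lemma Re_natmul (c : R[i]) (n : nat) : complex.Re (n%:R * c) = n%:R * complex.Re c.
Proof. by rewrite -[n%:R](rmorph_nat (real_complex R)); case: c => a b /=; rewrite mul0r subr0. Qed.

Lemma has_mean_sqnorm_exp (k : nat) (x y : R) :
  has_mean R (fun t => ((x + cos t) ^+ 2 + (y + sin t) ^+ 2) ^+ k)
    (\sum_(j < k.+1) ('C(k, j) ^ 2)%:R * (x ^+ 2 + y ^+ 2) ^+ j).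
Proof.
pose w : R[i] := x +i* y.
have qE z : (complex.Re z ^+ 2 + complex.Im z ^+ 2)%:C = z * z^* :> R[i].
  by rewrite add_Re2_Im2 sqr_normc.
have E t : ((x + cos t) ^+ 2 + (y + sin t) ^+ 2) ^+ k =
   \sum_(i < k.+1) \sum_(j < k.+1) ('C(k, i) * 'C(k, j))%:R *
     complex.Re ((w ^+ (k - i) * w^* ^+ (k - j)) * (circ t ^+ i * (circ t)^* ^+ j)).
  have -> : ((x + cos t) ^+ 2 + (y + sin t) ^+ 2) ^+ k =
     complex.Re ((w + circ t) ^+ k * (w^* + (circ t)^*) ^+ k).
    by rewrite -rmorphD/= -exprMn -qE -rmorphXn.
  rewrite !exprDn mulr_suml Re_sum; apply: eq_bigr => i _.
  rewrite mulr_sumr Re_sum; apply: eq_bigr => j _.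
  rewrite -Re_natmul natrM; congr complex.Re.
  rewrite -[_ *+ 'C(k, i)]mulr_natl -[_ *+ 'C(k, j)]mulr_natl; ring.
have -> := funext E.
have -> : \sum_(j < k.+1) ('C(k, j) ^ 2)%:R * (x ^+ 2 + y ^+ 2) ^+ j =
  \sum_(i < k.+1) \sum_(j < k.+1) ('C(k, i) * 'C(k, j))%:R *
    ((i == j :> nat)%:R * complex.Re (w ^+ (k - i) * w^* ^+ (k - j))).
  (* The expansion is indexed by the exponent of z, the claim by that of w, hence the reversal. *)
  rewrite (reindex_inj rev_ord_inj)/=; apply: eq_bigr => i _.
  rewrite (bigD1 i)//= eqxx mul1r big1 ?addr0 => [|j ji]; last first.
    by move: ji; rewrite eq_sym -val_eqE /= => /negbTE ->; rewrite mul0r mulr0.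
  rewrite subSS bin_sub -1?ltnS// -mulnn; congr (_ * _).
  by rewrite -exprMn -qE -rmorphXn.
do 2 (apply: has_mean_sum => ?).
by apply: has_meanZ; exact: has_mean_circ.
Qed.

(** Mean of |w + z_1 + ... + z_N|^(2k) for |w|^2 = q; by rotation invariance, w enters only through
    q. *)
Fixpoint walk_moment_from (N k : nat) (q : R) : R :=
  if N is N'.+1 then \sum_(j < k.+1) ('C(k, j) ^ 2)%:R * walk_moment_from N' j q
  else q ^+ k.

Lemma walk_moment_from0 (N k : nat) : walk_moment_from N k 0 = (walk_moment N k)%:R.
Proof.
elim: N k => [|N IH] k /=; first by rewrite expr0n.
by rewrite natr_sum; apply: eq_bigr => j _; rewrite IH natrM.
Qed.

(** The recursion is linear and passes q unchanged down to its base, so a random step inserted at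
    the start is averaged there, by [has_mean_sqnorm_exp]. *)
Lemma has_mean_walk_moment (N k : nat) (x y : R) :
  has_mean R (fun t => walk_moment_from N k ((x + cos t) ^+ 2 + (y + sin t) ^+ 2))
    (walk_moment_from N.+1 k (x ^+ 2 + y ^+ 2)).
Proof.
elim: N k => [|N IH] k; first exact: has_mean_sqnorm_exp.
by apply: has_mean_sum => j; apply: has_meanZ; exact: IH.
Qed.

Definition sqnorm_from (x y : R) (s : seq R) : R :=
  (x + \sum_(t <- s) cos t) ^+ 2 + (y + \sum_(t <- s) sin t) ^+ 2.

(* [angle_law] lives on the default measurable structure of [R], while the
   measure [uniform_prob] is declared on [measurableTypeR R]: the two have the same
   measurable sets but different displays, hence the pushforward along the identity. *)
Let idR : measurableTypeR R -> R := idfun.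

Let measurable_idR : measurable_fun setT idR.
Proof. exact: (@measurable_id _ _ setT). Qed.

#[local] HB.instance Definition _ := @isMeasurableFun.Build _ _ _ _ idR measurable_idR.

Local Notation mu := (uniform_prob (ltr_pwDr (zero_lt_2pi R) (lexx 0))).

Lemma angle_law_pushforward : @angle_law R = pushforward mu idR.
Proof. by []. Qed.

Lemma integral_angle_law (f : R -> R) (v : R) : has_mean R f v ->
  (\int[@angle_law R]_t (f t)%:E = v%:E)%E.
Proof.
move=> [fi fv]; rewrite angle_law_pushforward.
rewrite (@integral_pushforward _ _ _ _ R idR measurable_idR mu setT (EFin \o f))//.
by have /integrableP[] := fi.
Qed.

(** The starting point (x, y) is arbitrary because the integral over the first angle shifts it. *)
Lemma iid_expect_moments (N : nat) (I : finType) (v : I -> R) (e : I -> nat) (x y : R) :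
  iid_expect N (fun s => (\sum_i v i * sqnorm_from x y s ^+ e i)%:E) =
  (\sum_i v i * walk_moment_from N (e i) (x ^+ 2 + y ^+ 2))%:E.
Proof.
elim: N x y => [|N IH] x y /=.
  by rewrite /sqnorm_from !big_nil !addr0.
have H : has_mean R (fun t => \sum_i v i *
    walk_moment_from N (e i) ((x + cos t) ^+ 2 + (y + sin t) ^+ 2))
  (\sum_i v i * walk_moment_from N.+1 (e i) (x ^+ 2 + y ^+ 2)).
  by apply: has_mean_sum => i; apply: has_meanZ; exact: has_mean_walk_moment.
rewrite -(integral_angle_law _ _ H); congr (integral _ _ _).
apply/funext => t; rewrite -IH; congr iid_expect.
by apply/funext => s; rewrite /sqnorm_from !big_cons !addrA.
Qed.

(* No measurability is involved: the integral of a nonnegative function is defined as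
   the supremum over the simple functions below it. *)
Lemma le_iid_expect (N : nat) (f g : seq R -> \bar R) :
  (forall s, size s = N -> (f s <= g s)%E) -> (iid_expect N f <= iid_expect N g)%E.
Proof.
elim: N f g => [|N IH] f g fg /=; first exact: fg.
have {}IH t : (iid_expect N (fun s => f (t :: s)) <= iid_expect N (fun s => g (t :: s)))%E.
  by apply: IH => s sN; apply: fg; rewrite /= sN.
have mono (u v : R -> \bar R) : (forall t, 0 <= u t)%E -> (forall t, u t <= v t)%E ->
    (\int[pushforward mu idR]_t u t <= \int[pushforward mu idR]_t v t)%E.
  move=> u0 uv; have v0 t : (0 <= v t)%E by apply: le_trans (u0 t) _.
  rewrite !ge0_integralTE//.
  apply: le_ereal_sup => _ [h hu <-]; exists h => // t.
  exact: le_trans (hu t) (uv t).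
rewrite angle_law_pushforward integralE [leRHS]integralE.
apply: leeB; apply: mono => // t.
- by rewrite !funeposE ge_max !le_max IH lexx !orbT.
- by rewrite !funenegE ge_max !le_max leeN2 IH lexx !orbT.
Qed.

End WalkMoments.

(** * Probability that |S| is large *)

(** With g the polynomial of coefficients [a], the indicator of the event is pointwise at least 1 -
    g(|S|^2 / N)^2, whose mean is a combination of walk moments within B / N of 1 - E g(X)^2. *)
Lemma iid_prob_sqnorm_gt (R : realType) (K : nat) (a : nat -> R) (theta eps : R) :
  (forall x, 0 <= x <= theta -> 1 <= (\sum_(i < K) a i * x ^+ i) ^+ 2) ->
  \sum_(i < K) \sum_(j < K) a i * a j * (i + j)`!%:R < eps ->
  exists N0 : nat, forall N : nat, (N0 <= N)%N ->
    ((1 - eps)%:E <= iid_prob N [set s | theta * N%:R < sqnorm_from R 0 0 s]%R)%E.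
Proof.
move=> aP; set Lam := \sum_(i < K) _ => Leps.
pose B := \sum_(i < K) \sum_(j < K) `|a i * a j| * ((i + j)`! * (i + j) ^ 2)%:R.
have B0 : 0 <= B by rewrite sumr_ge0// => i _; rewrite sumr_ge0// => j _; rewrite mulr_ge0.
have D0 : 0 < eps - Lam by rewrite subr_gt0.
exists (Num.trunc (B / (eps - Lam))).+1 => N N0N.
have N0 : (0 < N)%N by apply: leq_trans N0N.
have NR : 0 < N%:R :> R by rewrite ltr0n.
have BN : B / N%:R <= eps - Lam.
  have y0 : 0 <= B / (eps - Lam) by rewrite divr_ge0// ltW.
  have /andP[_ yk] := Num.Theory.truncn_itv y0.
  rewrite ler_pdivrMr// mulrC -ler_pdivrMr// ltW// (lt_le_trans yk)// ler_nat//.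
(* Indexes the terms of 1 - g^2: one element for the constant 1, a pair (i, j) for each product of
   coefficients. *)
pose I : finType := ('I_1 + 'I_K * 'I_K)%type.
pose v (u : I) : R := match u with
  inl _ => 1 | inr ij => - (a ij.1 * a ij.2 / N%:R ^+ (ij.1 + ij.2)) end.
pose e (u : I) : nat := match u with inl _ => 0%N | inr ij => (ij.1 + ij.2)%N end.
have sumI (F : I -> R) : \sum_u F u = F (inl ord0) + \sum_(i < K) \sum_(j < K) F (inr (i, j)).
  rewrite big_sumType/= big_ord1 pair_bigA/=; congr (_ + _).
  by apply: eq_bigr => -[i j].
have pE (q : R) : \sum_u v u * q ^+ e u = 1 - (\sum_(i < K) a i * (q / N%:R) ^+ i) ^+ 2.
  rewrite sumI/= expr0 mulr1; congr (_ + _).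
  rewrite expr2 mulr_suml -sumrN; apply: eq_bigr => i _.
  rewrite mulr_sumr -sumrN; apply: eq_bigr => j _.
  by rewrite !expr_div_n !exprD invfM; ring.
have mE : 1 - eps <= \sum_u v u * walk_moment_from R N (e u) (0 ^+ 2 + 0 ^+ 2).
  rewrite sumI/= expr0n/= addr0 !walk_moment_from0.
  have -> : walk_moment N 0 = 1%N.
    apply/eqP; rewrite eqn_leq.
    by have := walk_moment_le N 0; have := walk_moment_ge N 0; rewrite ffactn0 expn0 => -> ->.
  rewrite mulr1 lerD2l lerNl -sumrN.
  apply: (@le_trans _ _ (Lam + B / N%:R)); last by rewrite -lerBrDl.
  rewrite /Lam /B mulr_suml -big_split/=; apply: ler_sum => i _.
  rewrite -sumrN mulr_suml -big_split/=; apply: ler_sum => j _.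
  rewrite mulNr opprK walk_moment_from0 -lerBlDl -[leRHS]mulrA.
  rewrite [a i * a j / _ * _]mulrAC -[_ * _ / _]mulrA -mulrBr.
  rewrite (le_trans (ler_norm _))// normrM ler_wpM2l//.
  exact: walk_moment_dist.
rewrite /iid_prob.
apply: (@le_trans _ _ (iid_expect N (fun s => (\sum_u v u * sqnorm_from R 0 0 s ^+ e u)%:E))).
  by rewrite iid_expect_moments lee_fin.
apply: le_iid_expect => s _; rewrite lee_fin pE indicE.
have [sN|sN] := boolP (s \in _); first by rewrite gerBl sqr_ge0.
rewrite subr_le0 aP//; apply/andP; split.
  by rewrite divr_ge0 ?ler0n// addr_ge0 ?sqr_ge0.
rewrite ler_pdivrMr// leNgt; apply/negP => h; move: sN => /negP; apply.
by rewrite inE.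
Qed.

Theorem mainTheorem15 (R : realType) (eps : R) :
  0 < eps < 1 ->
  exists N0 : nat, forall N : nat, (N0 <= N)%N ->
    ((1 - eps)%:E <=
     iid_prob N (max_event N
       (expR (gamma_const R * Num.sqrt pi * eps * Num.sqrt (N%:R) / 2))))%E.
Proof.
move=> eps01; have /andP[e0 e1] := eps01.
(* The exponent to reach is r sqrt N, so r^2 is the ratio theta. *)
pose r := gamma_const R * Num.sqrt pi * eps / 2.
have p0 : 0 <= pi :> R by exact: pi_ge0.
have r2 : r ^+ 2 = gamma_const R ^+ 2 * pi * eps ^+ 2 / 4.
  by rewrite /r !exprMn sqr_sqrtr//; move: (gamma_const R) (pi : R) => g p; field.
have r0 : 0 <= r.
  rewrite /r !mulr_ge0 ?sqrtr_ge0 ?invr_ge0 ?(ltW e0)//.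
  exact: (gamma_const_bound R).1.
have rle : r ^+ 2 <= 13%:R / 20%:R * eps ^+ 2.
  rewrite r2; have [_ +] := gamma_const_bound R; have : 0 < eps ^+ 2 by rewrite exprn_gt0.
  move: (gamma_const R ^+ 2 * pi) (eps ^+ 2) => g E2 E0 gle; clear -gle E0; nra.
have [K [a [aP aE]]] := exists_test_polynomial R _ _ eps01 rle.
have [N0 HN] := iid_prob_sqnorm_gt R K a (r ^+ 2) eps aP aE.
exists N0 => N N0N; apply: (le_trans (HN N N0N)).
apply: le_iid_expect => s sN; rewrite lee_fin !indicE.
have [sA|//] := boolP (s \in [set s | r ^+ 2 * N%:R < sqnorm_from R 0 0 s]).
rewrite mem_set//.
have -> : gamma_const R * Num.sqrt pi * eps * Num.sqrt N%:R / 2 = r * Num.sqrt N%:R.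
  by rewrite /r mulrAC.
apply: max_event_of_lt; first by rewrite mulr_ge0 ?sqrtr_ge0.
rewrite exprMn sqr_sqrtr ?ler0n//.
move: sA; rewrite inE/= /sqnorm_from !add0r.
have sumE (f : R -> R) : \sum_(t <- s) f t = \sum_(i < N) f (nth 0 s i).
  by rewrite (big_nth 0) big_mkord sN.
by rewrite !sumE.
Qed.
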